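(* Fix an integer $D\ge2$, a paraunitary waveform library $\{\mathbf S[\ell]\}_{\ell=0}^{L-1}$ of $D\times D$ matrices, a tolerance $\varepsilon>0$ and a constant $\eta_0\in(0,1]$. Then a null order growing linearly with $N\theta_w$ suffices to maintain the tolerance $\varepsilon$ throughout $|\theta|\le\theta_w$; specifically, one can choose $M=eN\theta_w+\mathcal O(1)$, in the following sense. There is a constant $C$ (depending only on $D$, the library, $\varepsilon$ and $\eta_0$) such that for every integer $N\ge1$ and every $\theta_w\ge0$ there is an integer $M\ge0$ with $$|M-eN\theta_w|\le C$$ such that, for every schedule $P=(p_0,\ldots,p_{N-1})\in\{0,\ldots,D-1\}^N$ and every nonzero weight vector $\mathbf q\in\mathbb C^N$ with $\eta_{\mathrm{SNR}}\ge\eta_0$ satisfying the moment-nulling conditions $\mu_{r,m}=0$ for all $r=1,\ldots,D-1$ and $m=0,\ldots,M$, one has $$\mathcal L(\theta)\ \le\ \frac{\Gamma_\Delta(D-1)}{DL\sqrt{\eta_{\mathrm{SNR}}}}\sum_{m=M+1}^{\infty}\frac{(N|\theta|)^m}{m!\sqrt{2m+1}}\ \le\ \varepsilon\qquad\text{for all real }\theta\text{ with }|\theta|\le\theta_w .$$ Here $e$ is Euler's number.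
   Context: Waveform library: matrices $\mathbf S[\ell]\in\mathbb C^{D\times D}$, $\ell=0,\ldots,L-1$ (with $\mathbf S[\ell]=\mathbf 0$ for other $\ell$), all of whose entries have modulus $1$, satisfying the paraunitary identity $\sum_{\ell=0}^{L-1}\mathbf S[\ell]\mathbf S^H[\ell-k]=DL\,\mathbf I_D\,\delta[k]$ for all integers $k$, where $\delta[k]$ is the Kronecker delta and $^H$ the conjugate transpose. Let $\mathbf s_d[\ell]$ be the $d$th column of $\mathbf S[\ell]$, $d=0,\ldots,D-1$, and $$\mathbf C_d[k]=\sum_{\ell=0}^{L-1}\mathbf s_d[\ell]\mathbf s_d^H[\ell-k].$$ Let $\omega=e^{j2\pi/D}$ ($j$ the imaginary unit). The mode correlation matrices are $\boldsymbol\Delta_r[k]=\sum_{d=0}^{D-1}\omega^{-rd}\mathbf C_d[k]$, and $$\Gamma_\Delta=\max_{k\ne0,\ 1\le r\le D-1}\|\boldsymbol\Delta_r[k]\|_2,$$ with $\|\cdot\|_2$ the spectral norm of a matrix ($k$ ranges over nonzero integers; only $|k|\le L-1$ contribute). For a schedule $P=(p_0,\ldots,p_{N-1})\in\{0,\ldots,D-1\}^N$ and weights $\mathbf q=(q_0,\ldots,q_{N-1})^T\in\mathbb C^N$: - slow-time moments: $\mu_{r,m}=\sum_{n=0}^{N-1}q_n\,\omega^{rp_n}n^m$ (with $0^0=1$); - SNR efficiency: $\eta_{\mathrm{SNR}}=\dfrac{|\mathbf 1_N^T\mathbf q|^2}{N\|\mathbf q\|_2^2}$, where $\mathbf 1_N$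 is the all-ones vector; - ambiguity matrix: $\boldsymbol\chi(k,\theta)=\sum_{n=0}^{N-1}q_n\,e^{jn\theta}\,\mathbf C_{p_n}[k]\in\mathbb C^{D\times D}$; - normalized peak sidelobe level: $\mathcal L(\theta)=\dfrac{\max_{k\ne0}\|\boldsymbol\chi(k,\theta)\|_2}{\|\boldsymbol\chi(0,0)\|_2}$. *)

(* Defs.v *)
From mathcomp Require Export all_boot all_order all_algebra.
From mathcomp Require Export complex.
From mathcomp Require Export all_classical all_reals all_analysis.

Set Implicit Arguments.
Unset Strict Implicit.
Unset Printing Implicit Defensive.

Import Order.TTheory GRing.Theory Num.Theory.
Import numFieldNormedType.Exports.

Local Open Scope classical_set_scope.
Local Open Scope sesquilinear_scope.
Local Open Scope complex_scope.
Local Open Scope ring_scope.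

(* e^{jt} *)
Definition cis (R : realType) (t : R) : R[i] := cos t +i* sin t.

Definition omega (R : realType) (D : nat) : R[i] := cis (2 * pi / D%:R).

Definition l2norm (R : realType) (n : nat) (x : 'cV[R[i]]_n) : R :=
  Num.sqrt (\sum_i Normc.normc (x i 0) ^+ 2).

(* The operator norm induced by l2norm; the library norm `|A| on matrices is
   the entrywise maximum. *)
Definition spectral_norm (R : realType) (m n : nat) (A : 'M[R[i]]_(m, n)) : R :=
  sup [set l2norm (A *m x) | x in [set x : 'cV[R[i]]_n | l2norm x <= 1]].

(* The sequence S is indexed by all integers, with support in {0, ..., L-1}. *)
Definition paraunitary_library (R : realType) (D L : nat)
    (S : int -> 'M[R[i]]_D) : Prop :=
  [/\ forall l : int, ~~ (0 <= l < L%:Z) -> S l = 0,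
      forall (l : int) (i j : 'I_D), 0 <= l < L%:Z -> `|S l i j| = 1
    & forall k : int,
        \sum_(l < L) S l%:Z *m (S (l%:Z - k)) ^t* =
        (if k == 0 then (D * L)%:R%:M else 0)].

Definition Ccorr (R : realType) (D L : nat) (S : int -> 'M[R[i]]_D)
    (d : 'I_D) (k : int) : 'M[R[i]]_D :=
  \sum_(l < L) col d (S l%:Z) *m (col d (S (l%:Z - k))) ^t*.

Definition modeDelta (R : realType) (D L : nat) (S : int -> 'M[R[i]]_D)
    (r : nat) (k : int) : 'M[R[i]]_D :=
  \sum_(d < D) omega R D ^- (r * d) *: Ccorr L S d k.

(* For a sequence S with finite support only finitely many of these norms are
   nonzero, so that this supremum, like the one in peak_sidelobe, is a maximum. *)
Definition GammaDelta (R : realType) (D L : nat) (S : int -> 'M[R[i]]_D) : R :=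
  sup [set x | exists (k : int) (r : nat),
    [/\ k != 0, (1 <= r <= D.-1)%N & x = spectral_norm (modeDelta L S r k)]].

Definition moment (R : realType) (D N : nat) (P : 'I_N -> 'I_D)
    (q : 'cV[R[i]]_N) (r m : nat) : R[i] :=
  \sum_(n < N) q n 0 * omega R D ^+ (r * P n) * n%:R ^+ m.

Definition eta_snr (R : realType) (N : nat) (q : 'cV[R[i]]_N) : R :=
  Normc.normc (\sum_(n < N) q n 0) ^+ 2 / (N%:R * l2norm q ^+ 2).

Definition ambiguity (R : realType) (D L N : nat) (S : int -> 'M[R[i]]_D)
    (P : 'I_N -> 'I_D) (q : 'cV[R[i]]_N) (k : int) (theta : R) : 'M[R[i]]_D :=
  \sum_(n < N) (q n 0 * cis (n%:R * theta)) *: Ccorr L S (P n) k.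

Definition peak_sidelobe (R : realType) (D L N : nat) (S : int -> 'M[R[i]]_D)
    (P : 'I_N -> 'I_D) (q : 'cV[R[i]]_N) (theta : R) : R :=
  sup [set spectral_norm (ambiguity L S P q k theta) |
       k in [set k : int | k != 0]]
  / spectral_norm (ambiguity L S P q 0 0).

(* Main.v *)
Require Import Defs.
From mathcomp Require Import all_boot all_order all_algebra complex.
From mathcomp Require Import all_classical all_reals all_analysis.
From mathcomp Require Import ring lra zify.

(* Fourier inversion over the schedule index gives D C_d = sum_r omega^(rd)
   Delta_r, so D chi(k, theta) = sum_r g_r(theta) Delta_r[k] with
   g_r(theta) = sum_n q_n omega^(r p_n) e^(jn theta).  Paraunitarity reads
   Delta_0[k] = DL delta[k] I: for k <> 0 only the D - 1 modes r >= 1 remain,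
   while at k = 0, theta = 0 the nulled moments of order 0 leave only r = 0.
   The Taylor coefficients of g_r are the moments mu_(r,m); those of order at
   most M vanish, and the others are bounded by Cauchy-Schwarz and
   (2m + 1) sum_(n < N) n^(2m) <= N^(2m + 1).  Finally, if m0 >= e X then
   X^m0 / m0! <= 1, since m0^m0 / m0! <= e^m0, and every later term of the
   exponential series is at most half of its predecessor; so the tail beyond
   m0 + j is at most 2^-j for every X <= m0 / e, with j independent of X. *)

Set Implicit Arguments.
Unset Strict Implicit.
Unset Printing Implicit Defensive.

Import Order.TTheory GRing.Theory Num.Theory.
Import numFieldNormedType.Exports.
Local Open Scope classical_set_scope.
Local Open Scope ring_scope.

Local Notation normc := Normc.normc.

(** Lagrange's identity: twice the gap between the squared sides is the double sum of
    [(a i * b j - a j * b i) ^+ 2]. *)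
Lemma CauchySchwarz_sum (R : rcfType) (I : finType) (a b : I -> R) :
  \sum_i a i * b i <=
    Num.sqrt (\sum_i a i ^+ 2) * Num.sqrt (\sum_i b i ^+ 2).
Proof.
have sq_ge0 (f : I -> R) : 0 <= \sum_i f i ^+ 2.
  by apply: sumr_ge0 => i _; exact: sqr_ge0.
rewrite -sqrtrM ?sq_ge0 //; apply: le_trans (ler_norm _) _.
rewrite -sqrtr_sqr ler_wsqrtr //.
rewrite -(ler_pM2l (ltr0n _ 2)) expr2 mulr_natl mulr2n [leRHS]mulr_natl mulr2n.
rewrite [X in _ <= _ + X]mulrC !big_distrlr /= -!big_split /=; apply: ler_sum => i _.
rewrite -!big_split; apply: ler_sum => j _ /=.
rewrite -subr_ge0.
have -> : a i ^+ 2 * b j ^+ 2 + b i ^+ 2 * a j ^+ 2 -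
  (a i * b i * (a j * b j) + a i * b i * (a j * b j)) =
  (a i * b j - a j * b i) ^+ 2 by ring.
exact: sqr_ge0.
Qed.

(** * Unit complex numbers and roots of unity *)

Section Complex.
Context {R : realType}.
Implicit Types (x y z : R[i]) (t : R).

Lemma normc_ge0 z : 0 <= normc z.
Proof. by case: z => a b; exact: sqrtr_ge0. Qed.

Lemma normcE_complex z : (`|z| = (normc z)%:C)%C.
Proof. by case: z. Qed.

Lemma normc_conj z : normc (z^*)%R = normc z.
Proof. by case: z => a b /=; rewrite sqrrN. Qed.

Lemma ler_normc_sum (I : Type) (r : seq I) (F : I -> R[i]) :
  normc (\sum_(i <- r) F i) <= \sum_(i <- r) normc (F i).
Proof.
elim/big_ind2: _ => // [|z a w b hz hw]; first by rewrite Normc.normc0.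
by rewrite (le_trans (le_normcD _ _)) // lerD.
Qed.

Lemma normcX z n : normc (z ^+ n) = normc z ^+ n.
Proof.
by elim: n => [|n IH]; rewrite ?expr0 ?Normc.normc1 // !exprS Normc.normcM IH.
Qed.

Lemma normc_nat n : normc n%:R = n%:R :> R.
Proof. by rewrite normcMn Normc.normc1. Qed.

Lemma cisD t u : cis (t + u) = cis t * cis u.
Proof.
rewrite /cis cosD sinD; apply/eqP; rewrite eq_complex /= eqxx /=.
by apply/eqP; ring.
Qed.

Lemma normc_cis t : normc (cis t) = 1.
Proof. by rewrite /= cos2Dsin2 sqrtr1. Qed.

Lemma cisX t n : cis t ^+ n = cis (n%:R * t).
Proof.
elim: n => [|n IH]; first by rewrite mul0r /cis cos0 sin0.
by rewrite exprS IH -cisD mulrSr mulrDl mul1r addrC.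
Qed.

(** If [cos t = 1], the half-angle formula forces [sin (t / 2) = 0], whereas [t / 2] lies strictly
    between 0 and [pi]. *)
Lemma cis_neq1 t : 0 < t < 2 * pi -> cis t != 1.
Proof.
move=> t_itv; have st : 0 < sin (t / 2) by apply: sin_gt0_pi; lra.
apply/eqP => /(congr1 (@complex.Re R)) /=.
have -> : t = (t / 2) *+ 2 by rewrite -mulr_natr; lra.
rewrite cos_mulr2n -mulr_natr => h; have := cos2Dsin2 (t / 2) => h2.
have : sin (t / 2) ^+ 2 = 0 by lra.
by move/eqP; rewrite sqrf_eq0 gt_eqF.
Qed.

Lemma normc_omega D : normc (omega R D) = 1.
Proof. exact: normc_cis. Qed.

Lemma omegaXD D : (0 < D)%N -> omega R D ^+ D = 1.
Proof.
move=> D0; rewrite /omega cisX mulrC divfK ?pnatr_eq0 -?lt0n //.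
rewrite /cis mulr_natl cos_mulr2n sin_mulr2n cospi sinpi mulr0 mul0rn.
by rewrite sqrrN expr1n mulr2n addrK.
Qed.

Lemma omegaX_neq1 D k : (0 < k < D)%N -> omega R D ^+ k != 1.
Proof.
move=> /andP[k0 kD]; rewrite cisX; apply: cis_neq1.
have D0 : 0 < D%:R :> R by rewrite ltr0n (leq_trans _ kD).
have k0' : 0 < k%:R :> R by rewrite ltr0n.
have kD' : k%:R < D%:R :> R by rewrite ltr_nat.
have pi0 := pi_gt0 R.
rewrite mulr_gt0 ?divr_gt0 ?mulr_gt0 //=.
by rewrite mulrA ltr_pdivrMr // [ltLHS]mulrC ltr_pM2l ?mulr_gt0.
Qed.

Lemma omega_neq0 D : omega R D != 0.
Proof.
by apply/eqP => /(congr1 (@Normc.normc R)); rewrite normc_omega Normc.normc0; lra.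
Qed.

Lemma omega_orthogonal D (d d' : 'I_D) :
  \sum_(r < D) omega R D ^+ (r * d) * omega R D ^- (r * d') =
  D%:R * (d == d')%:R.
Proof.
set w := omega R D; have w0 : w != 0 by exact: omega_neq0.
have D0 : (0 < D)%N by case: D d d' @w w0 => [[]|].
have -> : \sum_(r < D) w ^+ (r * d) * w ^- (r * d') =
    \sum_(r < D) (w ^+ d / w ^+ d') ^+ r.
  by apply: eq_bigr => r _; rewrite expr_div_n -!exprM ![(_ * r)%N]mulnC.
have [->|dd'] := eqVneq d d'.
  rewrite mulr1 divff ?expf_neq0 //.
  by under eq_bigr do rewrite expr1n; rewrite sumr_const card_ord.
rewrite mulr0; set z := w ^+ d / w ^+ d'.
have zD : z ^+ D = 1.
  by rewrite expr_div_n -!exprM ![(_ * D)%N]mulnC !exprM omegaXD // !expr1n divr1.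
(* The sum is geometric with ratio [z], and [z - 1] times it equals [z ^+ D - 1 = 0]. *)
suff z1 : z - 1 != 0.
  by apply: (mulfI z1); rewrite mulr0 -subrX1 zD subrr.
rewrite subr_eq0 /z; apply/eqP => h.
have {h} h : w ^+ d = w ^+ d' by rewrite -[RHS]mul1r -h divfK ?expf_neq0.
wlog lt : d d' dd' {z zD} h / (d < d')%N.
  move=> H; case: (ltngtP d d') => dd; first exact: (H d d').
    by apply: (H d' d); rewrite 1?eq_sym.
  by move/eqP: dd'; apply; exact: val_inj.
have := @omegaX_neq1 D (d' - d); rewrite subn_gt0 lt /=.
rewrite (leq_ltn_trans (leq_subr _ _) (ltn_ord d')) => /(_ isT)/eqP; apply.
by apply: (mulfI (expf_neq0 d w0)); rewrite mulr1 -exprD subnKC // ltnW.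
Qed.

End Complex.

(** * Euclidean and spectral norms *)

Section SpectralNorm.
Context {R : realType}.

Lemma sumr_sqr_ge0 (I : finType) (f : I -> R) : 0 <= \sum_i f i ^+ 2.
Proof. by apply: sumr_ge0 => i _; exact: sqr_ge0. Qed.

Lemma l2norm_ge0 n (x : 'cV[R[i]]_n) : 0 <= l2norm x.
Proof. exact: sqrtr_ge0. Qed.

Lemma l2norm_sq n (x : 'cV[R[i]]_n) : l2norm x ^+ 2 = \sum_i normc (x i 0) ^+ 2.
Proof. by rewrite sqr_sqrtr // sumr_sqr_ge0. Qed.

Lemma l2norm0 n : l2norm (0 : 'cV[R[i]]_n) = 0.
Proof.
rewrite /l2norm big1 ?sqrtr0 // => i _.
by rewrite mxE Normc.normc0 expr0n.
Qed.

Lemma l2normZ n c (x : 'cV[R[i]]_n) : l2norm (c *: x) = normc c * l2norm x.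
Proof.
rewrite /l2norm -[normc c]ger0_norm ?normc_ge0 // -sqrtr_sqr -sqrtrM ?sqr_ge0 //.
by rewrite mulr_sumr; congr Num.sqrt; apply: eq_bigr => i _;
  rewrite mxE Normc.normcM exprMn.
Qed.

Lemma ler_l2normD n (x y : 'cV[R[i]]_n) : l2norm (x + y) <= l2norm x + l2norm y.
Proof.
rewrite -(ler_pXn2r (n := 2)) ?nnegrE ?addr_ge0 ?l2norm_ge0 //.
rewrite sqrrD !l2norm_sq -mulr_natr.
have := @CauchySchwarz_sum R _ (fun i => normc (x i 0)) (fun i => normc (y i 0)).
rewrite -/(l2norm x) -/(l2norm y).
set s := \sum_i _ * _ => CS.
apply: (@le_trans _ _ (\sum_i normc (x i 0) ^+ 2 + s * 2 +
  \sum_i normc (y i 0) ^+ 2)); last by rewrite lerD2r lerD2l ler_pM2r.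
rewrite mulr_suml -!big_split; apply: ler_sum => i _ /=.
apply: (@le_trans _ _ ((normc (x i 0) + normc (y i 0)) ^+ 2)).
  by rewrite mxE ler_pXn2r ?nnegrE ?addr_ge0 ?normc_ge0 ?le_normcD.
by rewrite sqrrD -[in leLHS]mulr_natr.
Qed.

Lemma ler_l2norm_sum n (I : Type) (r : seq I) (F : I -> 'cV[R[i]]_n) :
  l2norm (\sum_(i <- r) F i) <= \sum_(i <- r) l2norm (F i).
Proof.
elim/big_ind2: _ => // [|z a w b hz hw]; first by rewrite l2norm0.
by rewrite (le_trans (ler_l2normD _ _)) // lerD.
Qed.

(** Cauchy-Schwarz on each row. The Frobenius norm thus bounds the set defining [spectral_norm],
    which makes that [sup] a genuine least upper bound. *)
Lemma ler_l2norm_mulmx m n (A : 'M[R[i]]_(m, n)) (x : 'cV[R[i]]_n) :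
  l2norm (A *m x) <= Num.sqrt (\sum_i \sum_j normc (A i j) ^+ 2) * l2norm x.
Proof.
rewrite -sqrtrM; last by apply: sumr_ge0 => i _; exact: sumr_sqr_ge0.
rewrite ler_wsqrtr // mulr_suml; apply: ler_sum => i _.
rewrite -[leRHS]sqr_sqrtr ?mulr_ge0 ?sumr_sqr_ge0 //.
rewrite ler_pXn2r ?nnegrE ?sqrtr_ge0 ?normc_ge0 // sqrtrM ?sumr_sqr_ge0 //.
apply: le_trans (CauchySchwarz_sum _ _); rewrite mxE.
apply: le_trans (ler_normc_sum _ _) _.
by apply: ler_sum => j _; rewrite Normc.normcM.
Qed.

Lemma has_sup_spectral_norm m n (A : 'M[R[i]]_(m, n)) :
  has_sup [set l2norm (A *m x) | x in [set x : 'cV[R[i]]_n | l2norm x <= 1]].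
Proof.
split; first by exists (l2norm (A *m 0)), 0 => //=; rewrite l2norm0.
exists (Num.sqrt (\sum_i \sum_j normc (A i j) ^+ 2)) => _ [x /= x1 <-].
by apply: le_trans (ler_l2norm_mulmx _ _) _; rewrite ler_piMr ?sqrtr_ge0.
Qed.

Lemma l2norm_mulmx_le_spectral m n (A : 'M[R[i]]_(m, n)) x :
  l2norm x <= 1 -> l2norm (A *m x) <= spectral_norm A.
Proof.
by move=> x1; apply: sup_upper_bound (has_sup_spectral_norm A) _ _; exists x.
Qed.

Lemma spectral_norm_le m n (A : 'M[R[i]]_(m, n)) b :
  (forall x, l2norm x <= 1 -> l2norm (A *m x) <= b) -> spectral_norm A <= b.
Proof.
move=> Ab; apply: ge_sup; first exact: (has_sup_spectral_norm A).1.
by move=> _ [x /= x1 <-]; exact: Ab.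
Qed.

Lemma spectral_norm_ge0 m n (A : 'M[R[i]]_(m, n)) : 0 <= spectral_norm A.
Proof.
by rewrite (le_trans (l2norm_ge0 (A *m 0))) ?l2norm_mulmx_le_spectral ?l2norm0.
Qed.

Lemma spectral_norm_le_frobenius m n (A : 'M[R[i]]_(m, n)) :
  spectral_norm A <= Num.sqrt (\sum_i \sum_j normc (A i j) ^+ 2).
Proof.
apply: spectral_norm_le => x x1.
by apply: le_trans (ler_l2norm_mulmx _ _) _; rewrite ler_piMr ?sqrtr_ge0.
Qed.

Lemma spectral_norm_scale_sum m n (I : Type) (r : seq I) (c : I -> R[i])
    (A : I -> 'M[R[i]]_(m, n)) :
  spectral_norm (\sum_(i <- r) c i *: A i) <=
  \sum_(i <- r) normc (c i) * spectral_norm (A i).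
Proof.
apply: spectral_norm_le => x x1; rewrite mulmx_suml.
apply: le_trans (ler_l2norm_sum _ _) _; apply: ler_sum => i _.
rewrite -scalemxAl l2normZ ler_wpM2l ?normc_ge0 //.
exact: l2norm_mulmx_le_spectral.
Qed.

(** Evaluating at the first basis vector gives the bound; a lower bound is what the denominator of
    the sidelobe level calls for. *)
Lemma spectral_norm_scalar_ge n (c : R[i]) :
  (0 < n)%N -> normc c <= spectral_norm (c%:M : 'M[R[i]]_n).
Proof.
case: n => // n _; have e1 : l2norm (delta_mx 0 0 : 'cV[R[i]]_n.+1) = 1.
  rewrite /l2norm (bigD1 0) //= mxE !eqxx Normc.normc1 expr1n big1 ?addr0 ?sqrtr1 //.
  by move=> i /negPf i0; rewrite mxE i0 Normc.normc0 expr0n.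
have -> : normc c = l2norm (c%:M *m (delta_mx 0 0 : 'cV[R[i]]_n.+1)).
  by rewrite mul_scalar_mx l2normZ e1 mulr1.
by apply: l2norm_mulmx_le_spectral; rewrite e1.
Qed.

End SpectralNorm.

(** * Power sums, Taylor expansion of [cis] and exponential tails *)

Lemma sum_expn_le N p : (p.+1 * \sum_(n < N) n ^ p <= N ^ p.+1)%N.
Proof.
(* The first two terms of the binomial expansion; summed over [n], this telescopes. *)
have bern n : (p.+1 * n ^ p + n ^ p.+1 <= n.+1 ^ p.+1)%N.
  elim: p => [|p IH]; first by rewrite expn0 !expn1 muln1 add1n.
  rewrite [leqRHS]expnS; apply: leq_trans (leq_mul (leqnn n.+1) IH).
  by rewrite ![(n ^ _.+1)%N]expnS; nia.
elim: N => [|N IH]; first by rewrite big_ord0 muln0.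
rewrite big_ord_recr /= mulnDr; apply: leq_trans (bern N).
by rewrite addnC leq_add2l.
Qed.

Section Analysis.
Context {R : realType}.

(** This is [(jt)^m / m!], assembled from the real cosine and sine terms so that convergence comes
    from the two real series; by parity, one component is always zero. *)
Definition cis_coeff (t : R) (m : nat) : R[i] :=
  Complex (cos_coeff t m) (sin_coeff t m).

Lemma normc_cis_coeff t m : normc (cis_coeff t m) = `|t| ^+ m / m`!%:R.
Proof.
have f0 : 0 < m`!%:R :> R by rewrite ltr0n fact_gt0.
rewrite /= /cos_coeff /sin_coeff /=.
have -> : `|t| ^+ m / m`!%:R = `|t ^+ m / m`!%:R|.
  by rewrite normrM normrX normfV (gtr0_norm f0).
rewrite -sqrtr_sqr; congr Num.sqrt.
case: (odd m) => /=; rewrite !(mul0r, mul1r) expr0n /= ?addr0 ?add0r.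
  by rewrite -mulrA exprMn sqrr_sign mul1r.
by rewrite -mulrA exprMn sqrr_sign mul1r.
Qed.

Lemma cis_coeffM (n : nat) t m :
  cis_coeff (n%:R * t) m = n%:R ^+ m * cis_coeff t m.
Proof.
have -> : n%:R ^+ m = Complex (n%:R ^+ m) 0 :> R[i].
  by rewrite -(rmorph_nat (real_complex R)) -(rmorphXn (real_complex R)).
apply/eqP; rewrite eq_complex /= /cos_coeff /sin_coeff /= exprMn.
by apply/andP; split; apply/eqP; ring.
Qed.

Lemma cis_series t K :
  \sum_(0 <= m < K) cis_coeff t m =
  Complex (series (cos_coeff t) K) (series (sin_coeff t) K).
Proof.
rewrite /series /=; elim: K => [|K IH]; first by rewrite !big_geq.
by rewrite !big_nat_recr //= IH.
Qed.

Lemma cvg_sumr (I : Type) (r : seq I) (f : I -> nat -> R) (l : I -> R) :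
  (forall i, f i @ \oo --> l i) ->
  (fun K => \sum_(i <- r) f i K) @ \oo --> \sum_(i <- r) l i.
Proof.
move=> fl; elim: r => [|i r IH].
  by under eq_fun do rewrite big_nil; rewrite big_nil; exact: cvg_cst.
under eq_fun do rewrite big_cons.
by rewrite big_cons; exact: cvgD.
Qed.

Lemma cvg_cis_series t :
  (fun K => normc (cis t - \sum_(0 <= m < K) cis_coeff t m)) @ \oo --> (0 : R).
Proof.
have hc : series (cos_coeff t) @ \oo --> cos t.
  by rewrite unlock; exact: is_cvg_series_cos_coeff.
have hs : series (sin_coeff t) @ \oo --> sin t.
  by rewrite unlock; exact: is_cvg_series_sin_coeff.
have dc : (fun K => (cos t - series (cos_coeff t) K) ^+ 2) @ \oo --> (0 : R).
  have d : (fun K => cos t - series (cos_coeff t) K) @ \oo --> (0 : R).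
    by rewrite -[X in _ --> X](subrr (cos t)); apply: cvgB hc; exact: cvg_cst.
  by rewrite -[X in _ --> X](mulr0 0); exact: (cvgM d d).
have ds : (fun K => (sin t - series (sin_coeff t) K) ^+ 2) @ \oo --> (0 : R).
  have d : (fun K => sin t - series (sin_coeff t) K) @ \oo --> (0 : R).
    by rewrite -[X in _ --> X](subrr (sin t)); apply: cvgB hs; exact: cvg_cst.
  by rewrite -[X in _ --> X](mulr0 0); exact: (cvgM d d).
under eq_fun do rewrite cis_series.
rewrite -sqrtr0 -[X in Num.sqrt X]addr0 /=.
apply: (@continuous_cvg _ _ _ _ _ _ Num.sqrt); first exact: sqrt_continuous.
exact: cvgD.
Qed.

(** Every Taylor partial sum obeys the bound, and the bound survives the limit. Taking [B] as a
    bound on all finite sections of the tail keeps the argument inside real sums. *)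
Lemma normc_cis_sum_le N (w : 'I_N -> R[i]) (M : nat) (theta B : R) :
    (forall m, (m <= M)%N -> \sum_(n < N) w n * n%:R ^+ m = 0) ->
    (forall K, \sum_(M.+1 <= m < K) (N%:R * `|theta|) ^+ m /
                 (m`!%:R * Num.sqrt (2 * m%:R + 1)) <= B) ->
  normc (\sum_(n < N) w n * cis (n%:R * theta)) <=
  Num.sqrt (\sum_(n < N) normc (w n) ^+ 2) * Num.sqrt N%:R * B.
Proof.
move=> w0 hB; set s := Num.sqrt _; set Y := s * _ * _.
(* Cauchy-Schwarz against [n ^ m], whose squares sum to at most [N ^ (2m + 1) / (2m + 1)]: the
   origin of the factor [Num.sqrt (2 * m%:R + 1)]. *)
have mom m : normc (\sum_(n < N) w n * n%:R ^+ m) <=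
    s * (Num.sqrt N%:R * (N%:R ^+ m / Num.sqrt (2 * m%:R + 1))).
  have p0 : 0 < 2 * m%:R + 1 :> R by rewrite ltr_wpDl ?mulr_ge0.
  apply: le_trans (ler_normc_sum _ _) _.
  under eq_bigr do rewrite Normc.normcM normcX normc_nat.
  apply: le_trans (CauchySchwarz_sum _ _) _.
  rewrite ler_wpM2l ?sqrtr_ge0 //.
  rewrite -[X in X / _]ger0_norm ?exprn_ge0 // -sqrtr_sqr -sqrtrV ?(ltW p0) //.
  rewrite -!sqrtrM ?sqr_ge0 ?ler0n // ler_wsqrtr // mulrA ler_pdivlMr //.
  have := sum_expn_le N (2 * m).
  rewrite -(ler_nat R) natrM natrX natr_sum -natr1 natrM mulrC exprS.
  rewrite [(2 * m)%N]mulnC exprM => h; apply: le_trans h.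
  rewrite ler_pM2r // ler_sum // => n _.
  by rewrite natrX exprM.
have part K : normc (\sum_(n < N) w n * \sum_(0 <= m < K) cis_coeff (n%:R * theta) m)
    <= Y.
  (* Since [n] leaves the coefficient as [n ^ m], exchanging the sums exposes the moments. *)
  have -> : \sum_(n < N) w n * \sum_(0 <= m < K) cis_coeff (n%:R * theta) m =
      \sum_(0 <= m < K) cis_coeff theta m * \sum_(n < N) w n * n%:R ^+ m.
    under eq_bigr do rewrite mulr_sumr.
    rewrite exchange_big; apply: eq_bigr => m _.
    by rewrite mulr_sumr; apply: eq_bigr => n _; rewrite cis_coeffM; ring.
  apply: (@le_trans _ _ (s * Num.sqrt N%:R * (\sum_(M.+1 <= m < K)
     (N%:R * `|theta|) ^+ m / (m`!%:R * Num.sqrt (2 * m%:R + 1))))); last first.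
    by rewrite ler_wpM2l ?mulr_ge0 ?sqrtr_ge0.
  have [KM|MK] := leqP K M.+1.
    rewrite [X in _ * X]big_geq // mulr0 big_nat_cond big1 ?Normc.normc0 //.
    by move=> m /andP[/andP[_ mK] _]; rewrite w0 ?mulr0 // -ltnS (leq_trans mK).
  rewrite (big_cat_nat (n := M.+1)) ?(ltnW MK) //= big_nat_cond big1 ?add0r; last first.
    by move=> m /andP[/andP[_ mK] _]; rewrite w0 ?mulr0.
  apply: le_trans (ler_normc_sum _ _) _.
  rewrite mulr_sumr; apply: ler_sum => m _.
  rewrite Normc.normcM normc_cis_coeff.
  apply: le_trans (ler_wpM2l _ (mom m)) _.
    by rewrite divr_ge0 ?exprn_ge0.
  by rewrite exprMn invfM le_eqVlt; apply/orP; left; apply/eqP; ring.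
rewrite -[leRHS]addr0.
(* For each [K] the target is at most [Y] plus the truncation error, and that error tends to 0. *)
have lim0 : (fun K => Y + \sum_(n < N) normc (w n) *
    normc (cis (n%:R * theta) - \sum_(0 <= m < K) cis_coeff (n%:R * theta) m))
    @ \oo --> Y + 0.
  apply: cvgD; first exact: cvg_cst.
  rewrite [X in _ --> X](_ : _ = \sum_(n < N) normc (w n) * 0); last first.
    by rewrite big1 // => n _; rewrite mulr0.
  apply: cvg_sumr => n; apply: cvgM; first exact: cvg_cst.
  exact: cvg_cis_series.
apply: (cvgr_to_ge lim0); apply: nearW => K.
apply: le_trans (lerD (part K) (lexx _)).
apply: (@le_trans _ _ (normc (\sum_(n < N) w n * \sum_(0 <= m < K) cis_coeff (n%:R * theta) m)
  + normc (\sum_(n < N) w n *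
    (cis (n%:R * theta) - \sum_(0 <= m < K) cis_coeff (n%:R * theta) m)))).
  apply: le_trans (le_normcD _ _); rewrite -big_split /= le_eqVlt; apply/orP; left.
  by apply/eqP; congr normc; apply: eq_bigr => n _; ring.
rewrite lerD2l; apply: le_trans (ler_normc_sum _ _) _.
by apply: ler_sum => n _; rewrite Normc.normcM.
Qed.

Lemma exp_term_le (X : R) m0 j : 0 <= X -> expR 1 * X <= m0%:R ->
  X ^+ (m0 + j) / (m0 + j)`!%:R <= 2 ^- j.
Proof.
move=> X0 Xm0; elim: j => [|j IH].
  rewrite addn0 invr1 ler_pdivrMr ?ltr0n ?fact_gt0 // mul1r.
  have : (expR 1 * X) ^+ m0 <= m0%:R ^+ m0.
    by rewrite lerXn2r ?nnegrE ?mulr_ge0 ?expR_ge0.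
  rewrite exprMn -expRM_natl mulr1 => h.
  case: m0 Xm0 h => [|m] _ h; first by rewrite expr0 fact0.
  (* A single term of the exponential series at [m0] is at most [e^m0]; the factor [e^m0] then
     cancels against [(e X)^m0]. *)
  have := @expR_ge1Dxn R m.+1%:R m (ler0n _ _).
  have f0 : 0 < m.+1`!%:R :> R by rewrite ltr0n fact_gt0.
  move=> h2; have {h2} : m.+1%:R ^+ m.+1 / m.+1`!%:R <= expR (m.+1%:R : R) by lra.
  rewrite ler_pdivrMr // => h2.
  by have := le_trans h h2; rewrite ler_pM2l ?expR_gt0.
rewrite addnS factS natrM exprS invfM exprSr invfM mulrACA [leRHS]mulrC.
apply: ler_pM => //.
- by rewrite divr_ge0.
- by rewrite divr_ge0 ?exprn_ge0.
(* The ratio of consecutive terms is at most one half: [2 X <= e X <= m0]. *)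
- rewrite ler_pdivrMr // ler_pdivlMl //.
  apply: (@le_trans _ _ (expR 1 * X)); last first.
    by apply: le_trans Xm0 _; rewrite ler_nat; lia.
  rewrite ler_wpM2r //; have := @expR_ge1Dx R 1; lra.
Qed.

Lemma exp_tail_le (X : R) m0 j K : 0 <= X -> expR 1 * X <= m0%:R ->
  \sum_((m0 + j).+1 <= m < K) X ^+ m / (m`!%:R * Num.sqrt (2 * m%:R + 1)) <=
  2 ^- j.
Proof.
move=> X0 Xm0.
(* Subtracting the remainder [2 ^- (j + k)] makes the geometric bound inductive; the square roots
   are at least 1 and are dropped. *)
have tail k : \sum_((m0 + j).+1 <= m < (m0 + j).+1 + k)
    X ^+ m / (m`!%:R * Num.sqrt (2 * m%:R + 1)) <= 2 ^- j - 2 ^- (j + k).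
  elim: k => [|k IH]; first by rewrite !addn0 big_geq // subrr.
  rewrite addnS big_nat_recr ?leq_addr //=.
  have f0 n : 0 < n`!%:R :> R by rewrite ltr0n fact_gt0.
  set m := ((m0 + j).+1 + k)%N.
  have s1 : 1 <= Num.sqrt (2 * m%:R + 1) :> R.
    by rewrite -[leLHS]sqrtr1 ler_wsqrtr // lerDr mulr_ge0.
  have : X ^+ m / (m`!%:R * Num.sqrt (2 * m%:R + 1)) <= 2 ^- (j + k).+1.
    apply: le_trans (@exp_term_le X m0 (j + k).+1 X0 Xm0).
    have -> : (m0 + (j + k).+1)%N = m by rewrite /m; lia.
    have s0 := lt_le_trans ltr01 s1.
    rewrite ler_wpM2l ?exprn_ge0 // lef_pV2 ?posrE ?mulr_gt0 ?f0 //.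
    by rewrite ler_peMr // ltW.
  rewrite addnS exprS invfM; move: IH; lra.
have [K0|K0] := leqP K (m0 + j).+1; first by rewrite big_geq // invr_ge0 exprn_ge0.
have := tail (K - (m0 + j).+1)%N; rewrite subnKC ?(ltnW K0) // => h.
by apply: le_trans h _; rewrite gerBl invr_ge0 exprn_ge0.
Qed.

End Analysis.

(** * Mode correlation matrices of a paraunitary library *)

Section Library.
Context {R : realType} {D L : nat} {S : int -> 'M[R[i]]_D}.

Lemma sum_Ccorr k :
  \sum_(d < D) Ccorr L S d k =
  \sum_(l < L) S l%:Z *m ((S (l%:Z - k)) ^t* )%sesqui.
Proof.
rewrite exchange_big; apply: eq_bigr => l _ /=; apply/matrixP => i j.
rewrite summxE mxE; apply: eq_bigr => d _.
by rewrite mxE big_ord1 !mxE.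
Qed.

Lemma sum_modeDelta (d : 'I_D) k :
  \sum_(r < D) omega R D ^+ (r * d) *: modeDelta L S r k =
  D%:R *: Ccorr L S d k.
Proof.
under eq_bigr do rewrite scaler_sumr.
rewrite exchange_big /= (bigD1 d) //= [X in _ + X]big1 ?addr0 => [|d' dd'].
  under eq_bigr do rewrite scalerA.
  by rewrite -scaler_suml omega_orthogonal eqxx mulr1.
under eq_bigr do rewrite scalerA.
by rewrite -scaler_suml omega_orthogonal eq_sym (negPf dd') mulr0 scale0r.
Qed.

Lemma ambiguity_modes N (P : 'I_N -> 'I_D) (q : 'cV[R[i]]_N) k theta :
  D%:R *: ambiguity L S P q k theta =
  \sum_(r < D) (\sum_(n < N) q n 0 * omega R D ^+ (r * P n) *
                  cis (n%:R * theta)) *: modeDelta L S r k.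
Proof.
rewrite scaler_sumr.
under [RHS]eq_bigr do rewrite scaler_suml.
rewrite exchange_big; apply: eq_bigr => n _ /=.
rewrite scalerA mulrC -scalerA -sum_modeDelta scaler_sumr.
by apply: eq_bigr => r _; rewrite scalerA mulrAC.
Qed.

Context (hS : paraunitary_library L S).

Lemma modeDelta0 k :
  modeDelta L S 0 k = if k == 0 then (D * L)%:R%:M else 0.
Proof.
have [_ _ <-] := hS; rewrite -sum_Ccorr; apply: eq_bigr => d _.
by rewrite mul0n expr0 invr1 scale1r.
Qed.

Lemma normc_library_le1 l i j : normc (S l i j) <= 1.
Proof.
have [S0 S1 _] := hS; have [hl|hl] := boolP (0 <= l < L%:Z); last first.
  by rewrite S0 // mxE Normc.normc0.
have /(congr1 (@complex.Re R)) := S1 l i j hl.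
by rewrite normcE_complex /= => ->.
Qed.

(** There are [D * L] summands of modulus at most 1. Uniformity in [r] and [k] bounds the set whose
    supremum is [GammaDelta]. *)
Lemma normc_modeDelta_le r k i j : normc (modeDelta L S r k i j) <= (D * L)%:R.
Proof.
rewrite natrM /modeDelta summxE.
have -> : D%:R * L%:R = \sum_(d < D) (L%:R : R).
  by rewrite sumr_const card_ord mulr_natl.
apply: le_trans (ler_normc_sum _ _) _; apply: ler_sum => d _.
rewrite mxE Normc.normcM Normc.normcV normcX normc_omega expr1n invr1 mul1r.
rewrite summxE; have -> : L%:R = \sum_(l < L) (1 : R).
  by rewrite sumr_const card_ord.
apply: le_trans (ler_normc_sum _ _) _; apply: ler_sum => l _.
rewrite mxE big_ord1 !mxE Normc.normcM normc_conj.
by rewrite mulr_ile1 ?normc_ge0 ?normc_library_le1.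
Qed.

Lemma modeDelta_le_Gamma r k : k != 0 -> (1 <= r <= D.-1)%N ->
  spectral_norm (modeDelta L S r k) <= GammaDelta L S.
Proof.
move=> k0 hr; apply: ub_le_sup; last by exists k, r.
exists (Num.sqrt (\sum_(i < D) \sum_(j < D) (D * L)%:R ^+ 2)).
move=> _ [k' [r' [_ _ ->]]]; apply: le_trans (spectral_norm_le_frobenius _) _.
rewrite ler_wsqrtr //; apply: ler_sum => i _; apply: ler_sum => j _.
by rewrite lerXn2r ?nnegrE ?normc_ge0 // normc_modeDelta_le.
Qed.

Lemma GammaDelta_ge0 : (2 <= D)%N -> 0 <= GammaDelta L S.
Proof.
move=> hD; apply: le_trans (spectral_norm_ge0 (modeDelta L S 1 1)) _.
by apply: modeDelta_le_Gamma; lia.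
Qed.

(** * Sidelobe bound for a schedule with nulled moments *)

Section Schedule.
Context {N M : nat} {P : 'I_N -> 'I_D} {q : 'cV[R[i]]_N}.
Context (nulls : forall r m : nat,
  (1 <= r <= D.-1)%N -> (m <= M)%N -> moment P q r m = 0).

Lemma spectral_norm_ambiguity_le k theta B : (2 <= D)%N -> k != 0 ->
  (forall K, \sum_(M.+1 <= m < K) (N%:R * `|theta|) ^+ m /
               (m`!%:R * Num.sqrt (2 * m%:R + 1)) <= B) ->
  D%:R * spectral_norm (ambiguity L S P q k theta) <=
  (D.-1)%:R * (l2norm q * Num.sqrt N%:R * B * GammaDelta L S).
Proof.
move=> hD k0 hB.
have nD : normc D%:R = D%:R :> R := normc_nat D.
have D0 : 0 < D%:R :> R by rewrite ltr0n; lia.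
have hZ : D%:R * spectral_norm (ambiguity L S P q k theta) <=
    spectral_norm (D%:R *: ambiguity L S P q k theta).
  rewrite -ler_pdivlMl //; apply: spectral_norm_le => x x1.
  rewrite ler_pdivlMl // -[X in X * _]normc_nat -l2normZ scalemxAl.
  exact: l2norm_mulmx_le_spectral.
apply: le_trans hZ _; rewrite ambiguity_modes.
apply: le_trans (spectral_norm_scale_sum _ _ _) _.
have lD : (0 < D)%N by lia.
rewrite (bigD1 (Ordinal lD)) //= modeDelta0 (negPf k0).
have -> : spectral_norm (0 : 'M[R[i]]_D) = 0.
  apply/eqP; rewrite eq_le spectral_norm_ge0 andbT.
  by apply: spectral_norm_le => x _; rewrite mul0mx l2norm0.
rewrite mulr0 add0r.
have -> : D.-1%:R = \sum_(r < D | r != Ordinal lD) 1 :> R.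
  by rewrite sumr_const cardC1 card_ord.
rewrite mulr_suml; apply: ler_sum => r r0; rewrite mul1r.
have hr : (1 <= r <= D.-1)%N.
  have := ltn_ord r; have : nat_of_ord r != 0%N by exact: r0.
  lia.
apply: ler_pM; rewrite ?normc_ge0 ?spectral_norm_ge0 ?modeDelta_le_Gamma //.
(* The phases [omega ^ (r p_n)] are unimodular, so all modes share the same weight norm. *)
have -> : l2norm q =
    Num.sqrt (\sum_(n < N) normc (q n 0 * omega R D ^+ (r * P n)) ^+ 2).
  congr Num.sqrt; apply: eq_bigr => n _.
  by rewrite Normc.normcM normcX normc_omega expr1n mulr1.
by apply: normc_cis_sum_le hB => m hm; exact: nulls.
Qed.

Lemma spectral_norm_ambiguity00_ge : (2 <= D)%N ->
  L%:R * normc (\sum_(n < N) q n 0) <= spectral_norm (ambiguity L S P q 0 0).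
Proof.
move=> hD; have lD : (0 < D)%N by lia.
have D0 : D%:R != 0 :> R[i] by rewrite pnatr_eq0; lia.
suff -> : ambiguity L S P q 0 0 = (L%:R * \sum_(n < N) q n 0)%:M.
  by rewrite -[X in X * _]normc_nat -Normc.normcM; exact: spectral_norm_scalar_ge.
apply: (scalerI D0); rewrite ambiguity_modes.
rewrite (bigD1 (Ordinal lD)) //= modeDelta0 eqxx [X in _ + X = _]big1 ?addr0 => [|r r0].
  rewrite !scale_scalar_mx; congr scalar_mx.
  rewrite natrM [LHS]mulrC mulrA; congr (_ * _); apply: eq_bigr => n _.
  by rewrite mul0n expr0 mulr0 /cis cos0 sin0 !mulr1.
have hr : (1 <= r <= D.-1)%N.
  have := ltn_ord r; have : nat_of_ord r != 0%N by exact: r0.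
  lia.
(* At zero Doppler the coefficient of mode [r] is the moment of order 0. *)
rewrite [X in X *: _](_ : _ = 0) ?scale0r // -[RHS](nulls hr (leq0n M)).
by apply: eq_bigr => n _; rewrite expr0 mulr0 /cis cos0 sin0.
Qed.

Lemma peak_sidelobe_le theta B : (2 <= D)%N -> (0 < L)%N ->
  0 < eta_snr q ->
  (forall K, \sum_(M.+1 <= m < K) (N%:R * `|theta|) ^+ m /
               (m`!%:R * Num.sqrt (2 * m%:R + 1)) <= B) ->
  peak_sidelobe L S P q theta <=
  GammaDelta L S * (D.-1)%:R / ((D * L)%:R * Num.sqrt (eta_snr q)) * B.
Proof.
move=> hD hL eta0 hB.
have D0 : 0 < D%:R :> R by rewrite ltr0n; lia.
have L0 : 0 < L%:R :> R by rewrite ltr0n.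
set Q := normc (\sum_(n < N) q n 0).
have Q0 : 0 < Q.
  rewrite lt_neqAle normc_ge0 andbT eq_sym; apply/eqP => Qz.
  by move: eta0; rewrite /eta_snr -/Q Qz expr0n mul0r ltxx.
(* Division by zero yields 0, so a positive efficiency rules out a vanishing denominator. *)
have nq0 : 0 < Num.sqrt N%:R * l2norm q.
  rewrite lt_neqAle mulr_ge0 ?sqrtr_ge0 ?l2norm_ge0 // andbT eq_sym.
  apply/eqP => nz; move: eta0; rewrite /eta_snr.
  by rewrite -[N%:R]sqr_sqrtr // -exprMn nz expr0n invr0 mulr0 ltxx.
have -> : Num.sqrt (eta_snr q) = Q / (Num.sqrt N%:R * l2norm q).
  rewrite /eta_snr -[N%:R in LHS]sqr_sqrtr // -exprMn -expr_div_n sqrtr_sqr.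
  by rewrite gtr0_norm ?divr_gt0.
have den := spectral_norm_ambiguity00_ge hD.
have den0 : 0 < spectral_norm (ambiguity L S P q 0 0).
  by apply: lt_le_trans den; rewrite mulr_gt0.
have B0 : 0 <= B by have := hB 0%N; rewrite big_geq.
rewrite /peak_sidelobe ler_pdivrMr //.
apply: ge_sup.
  by exists (spectral_norm (ambiguity L S P q 1 theta)), 1.
move=> _ [k /= k0 <-].
have amb := spectral_norm_ambiguity_le hD k0 hB.
rewrite -(ler_pM2l D0); apply: le_trans amb _.
apply: (@le_trans _ _ (D%:R * (GammaDelta L S * D.-1%:R /
  ((D * L)%:R * (Q / (Num.sqrt N%:R * l2norm q))) * B * (L%:R * Q)))).
  rewrite le_eqVlt; apply/orP; left; apply/eqP; rewrite natrM.
  have nq1 : l2norm q != 0 by apply: contraTneq nq0 => ->; rewrite mulr0 ltxx.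
  have sN1 : Num.sqrt N%:R != 0 :> R by apply: contraTneq nq0 => ->; rewrite mul0r ltxx.
  by field; rewrite nq1 sN1 !gt_eqF.
rewrite ler_pM2l // ler_wpM2l // mulr_ge0 //.
by rewrite divr_ge0 // mulr_ge0 ?GammaDelta_ge0 // divr_ge0 // ltW.
Qed.

End Schedule.
End Library.

(** * Choice of the null order and conclusion *)

Lemma truncn_ceil_itv (R : realType) (x : R) : 0 <= x ->
  x <= (Num.truncn x).+1%:R <= x + 1.
Proof.
by move=> x0; have /andP[h1 h2] := truncn_itv x0; rewrite (ltW h2) -natr1 lerD2r.
Qed.

Lemma truncn_add_dist (R : realType) (x : R) j : 0 <= x ->
  `|((Num.truncn x).+1 + j)%:R - x| <= j%:R + 1.
Proof.
move=> /truncn_ceil_itv; rewrite natrD.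
move: (_.+1%:R) (ler0n R j) => a; move: (j%:R) => b b0 /andP[h1 h2].
by rewrite ler_norml; apply/andP; split; lra.
Qed.

Unset Implicit Arguments.

Theorem mainTheorem3 (R : realType) (D L : nat) (S : int -> 'M[R[i]]_D)
    (eps eta0 : R) (hD : (2 <= D)%N) (hL : (0 < L)%N)
    (hS : paraunitary_library L S) (heps : 0 < eps) (heta0 : 0 < eta0 <= 1) :
  exists C : R, forall (N : nat) (theta_w : R), (1 <= N)%N -> 0 <= theta_w ->
    exists M : nat,
      `|M%:R - expR 1 * N%:R * theta_w| <= C /\
      forall (P : 'I_N -> 'I_D) (q : 'cV[R[i]]_N),
        q != 0 -> eta0 <= eta_snr q ->
        (forall r m : nat, (1 <= r <= D.-1)%N -> (m <= M)%N ->
          moment P q r m = 0) ->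
        forall theta : R, `|theta| <= theta_w ->
          ((peak_sidelobe L S P q theta)%:E
           <= (GammaDelta L S * (D.-1)%:R
                 / ((D * L)%:R * Num.sqrt (eta_snr q)))%:E
              * \sum_(M.+1 <= m <oo)
                  ((N%:R * `|theta|) ^+ m
                     / (m`!%:R * Num.sqrt (2 * m%:R + 1)))%:E
           <= eps%:E)%E.
Proof.
have /andP[eta0_gt0 _] := heta0.
have G0 := GammaDelta_ge0 hS hD.
(* The largest prefactor compatible with [eta0 <= eta_snr q], hence independent of schedule and
   weights. *)
pose A := GammaDelta L S * D.-1%:R / ((D * L)%:R * Num.sqrt eta0).
have A0 : 0 <= A by rewrite divr_ge0 ?mulr_ge0 ?sqrtr_ge0.
(* Enough extra orders, because [2 ^ j > j >= A / eps]. *)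
pose j := (Num.truncn (A / eps)).+1.
have Aj : A * 2 ^- j <= eps.
  rewrite ler_pdivrMr ?exprn_gt0 // mulrC -ler_pdivrMr //.
  have Ae : 0 <= A / eps by rewrite divr_ge0 // ltW.
  have /andP[h _] := truncn_ceil_itv Ae; apply: le_trans h _.
  by rewrite -natrX ler_nat ltnW // ltn_expl.
(* In the constant, [j] counts the extra orders and 1 pays for rounding [e N theta_w] up to [m0]. *)
exists (j%:R + 1) => N theta_w hN tw0.
pose m0 := (Num.truncn (expR 1 * N%:R * theta_w)).+1.
have X0 : 0 <= expR 1 * N%:R * theta_w by rewrite !mulr_ge0 ?expR_ge0.
have /andP[m0l _] := truncn_ceil_itv X0; rewrite -/m0 in m0l.
exists (m0 + j)%N; split; first exact: truncn_add_dist.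
move=> P q _ heta nulls theta th.
have eta_gt0 : 0 < eta_snr q by exact: lt_le_trans heta.
have tail K : \sum_((m0 + j).+1 <= m < K) (N%:R * `|theta|) ^+ m /
    (m`!%:R * Num.sqrt (2 * m%:R + 1)) <= 2 ^- j :> R.
  apply: exp_tail_le; first by rewrite mulr_ge0.
  by apply: le_trans m0l; rewrite mulrA ler_wpM2l // mulr_ge0 ?expR_ge0.
pose a (m : nat) :=
  ((N%:R * `|theta|) ^+ m / (m`!%:R * Num.sqrt (2 * m%:R + 1)))%:E.
set c := _ / _; set T := (\sum_(_ <= m <oo) _)%E.
have c0 : 0 <= c by rewrite /c divr_ge0 ?mulr_ge0 ?sqrtr_ge0.
have a0 m : (0 <= a m)%E.
  by rewrite lee_fin divr_ge0 ?mulr_ge0 ?sqrtr_ge0 ?exprn_ge0 ?mulr_ge0.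
have T0 : (0 <= T)%E by apply: nneseries_ge0 => m _ _; exact: a0.
have Tj : (T <= (2 ^- j)%:E)%E.
  apply: lime_le; first by apply: is_cvg_nneseries => m _ _; exact: a0.
  by apply: nearW => K; rewrite sumEFin lee_fin; exact: tail.
(* Finiteness lets the real number [fine T] serve as the bound [B] on the partial sums. *)
have Tfin : T \is a fin_num.
  by rewrite ge0_fin_numE //; apply: le_lt_trans Tj _; exact: ltry.
apply/andP; split.
  rewrite -(fineK Tfin) -EFinM lee_fin; apply: (peak_sidelobe_le hS nulls) => //.
  move=> K; rewrite -lee_fin (fineK Tfin) -sumEFin.
  by apply: nneseries_lim_ge => m _ _; exact: a0.
(* What remains is [c <= A], by monotonicity of the square root in the efficiency. *)
apply: (@le_trans _ _ (c%:E * (2 ^- j)%:E)%E); first exact: lee_wpmul2l.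
rewrite -EFinM lee_fin; apply: le_trans Aj.
rewrite ler_wpM2r ?invr_ge0 ?exprn_ge0 // ler_wpM2l ?mulr_ge0 //.
have DL0 : 0 < (D * L)%:R :> R by rewrite ltr0n muln_gt0 hL (ltnW hD).
by rewrite lef_pV2 ?posrE ?mulr_gt0 ?sqrtr_gt0 // ler_wpM2l // ler_wsqrtr.
Qed.
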